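(* Let $(X,J)$ be a compact almost-complex manifold of real dimension $4$. Then $h^{1,1}_{\overline\partial}$ is a conformal invariant of Hermitian metrics; that is, if $\omega$ and $\tilde\omega=\Phi\omega$ are Hermitian metrics on $(X,J)$, with $\Phi$ a smooth positive real function on $X$, then $h^{1,1}_{\overline\partial,\tilde\omega}=h^{1,1}_{\overline\partial,\omega}$.
   Context: The almost-complex structure $J$ is not assumed integrable. A Hermitian metric on $(X,J)$ is a $J$-invariant Riemannian metric $g$, identified with its fundamental $(1,1)$-form $\omega(\cdot,\cdot)=g(J\cdot,\cdot)$. $A^{p,q}(X)$ denotes the space of smooth complex-valued $(p,q)$-forms with respect to $J$. On $A^{p,q}(X)$ the operator $\overline\partial: A^{p,q}(X)\to A^{p,q+1}(X)$ is the $(p,q+1)$-component of the exterior derivative $d$ (in general $\overline\partial^2\neq 0$), and $\overline\partial^*$ is its formal $L^2$-adjoint with respect to the given Hermitian metric. The $\overline\partial$-Laplacian is $\Delta_{\overline\partial}=\overline\partial\,\overline\partial^*+\overline\partial^*\overline\partial$, a second order elliptic operator. For a Hermitian metric $\omega$, $\mathcal H^{p,q}_{\overline\partial,\omega}=\ker(\Delta_{\overline\partial}|_{A^{p,q}(X)})$ and $h^{p,q}_{\overline\partial,\omega}=\dim_{\mathbb C}\mathcal H^{p,q}_{\overline\partial,\omega}$, which is finite since $X$ is compact. *)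

(* Defs.v *)
From mathcomp Require Import all_boot all_order all_algebra complex.
From mathcomp Require Import all_classical all_reals all_analysis.
Set Implicit Arguments.
Unset Strict Implicit.
Unset Printing Implicit Defensive.
Import Order.TTheory GRing.Theory Num.Theory.
Import numFieldNormedType.Exports.
Local Open Scope classical_set_scope.
Local Open Scope complex_scope.
Local Open Scope ring_scope.

(* Smooth functions on R^n.  Vectors are row vectors and linear maps act by    *)
(* right multiplication, as for the library's jacobian.                        *)

Definition partial (R : realType) n (j : 'I_n) (f : 'rV[R]_n -> R)
    (y : 'rV[R]_n) : R :=
  'D_(delta_mx 0 j) (f : 'rV[R]_n -> R^o) y.

Definition iter_partial (R : realType) n (s : seq 'I_n) (f : 'rV[R]_n -> R) :
    'rV[R]_n -> R :=
  foldr (@partial R n) f s.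

(* C^infinity on a set U which is always open below *)
Definition smooth_on (R : realType) n (U : set 'rV[R]_n)
    (f : 'rV[R]_n -> R) : Prop :=
  forall (s : seq 'I_n) (y : 'rV[R]_n), U y ->
    {for y, continuous (iter_partial s f)} /\
    (forall j : 'I_n,
       derivable (iter_partial s f : 'rV[R]_n -> R^o) y (delta_mx 0 j)).

Definition csmooth_on (R : realType) n (U : set 'rV[R]_n)
    (f : 'rV[R]_n -> R[i]) : Prop :=
  smooth_on U (fun y => complex.Re (f y)) /\
  smooth_on U (fun y => complex.Im (f y)).

Definition cpartial (R : realType) n (j : 'I_n) (f : 'rV[R]_n -> R[i])
    (y : 'rV[R]_n) : R[i] :=
  partial j (fun z => complex.Re (f z)) y +i*
  partial j (fun z => complex.Im (f z)) y.

(* Iterated one-dimensional Lebesgue integrals; by Fubini this is integration  *)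
(* over R^n for the continuous compactly supported functions it is applied to. *)
Fixpoint integral_Rn (R : realType) n : ('rV[R]_n -> R) -> R :=
  match n with
  | 0%N => fun f => f 0
  | n'.+1 => fun f =>
      Rintegral (@lebesgue_measure R) setT
        (fun t : R => integral_Rn
           (fun v : 'rV[R]_n' => f (row_mx (t%:M : 'rV[R]_1) v)))
  end.

(* A smooth structure of dimension n on X, given by a smooth atlas; param c is *)
(* the inverse of the chart coord c, and its values off chart_image c are      *)
(* irrelevant.                                                                 *)
Record smooth_atlas (R : realType) (n : nat) (X : topologicalType) := SmoothAtlas {
  chart : Type;
  dom : chart -> set X;
  coord : chart -> X -> 'rV[R]_n;
  param : chart -> 'rV[R]_n -> X;
  dom_open : forall c, open (dom c);
  dom_cover : forall x, exists c, dom c x;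
  image_open : forall c, open (coord c @` dom c);
  coordK : forall c x, dom c x -> param c (coord c x) = x;
  coord_continuous : forall c x, dom c x -> {for x, continuous (coord c)};
  param_continuous : forall c x, dom c x ->
    {for coord c x, continuous (param c)};
  transition_smooth : forall c c' (j : 'I_n),
    smooth_on (coord c @` (dom c `&` dom c'))
      (fun y => coord c' (param c y) 0 j)
}.

Section Manifold.
Variables (R : realType) (n : nat) (X : topologicalType).
Variable A : smooth_atlas R n X.
Implicit Types (c : chart A) (x : X).

Definition chart_image c : set 'rV[R]_n := coord c @` dom c.

(* v *m jac c c' x are the components in the chart c' of the tangent vector at *)
(* x with components v in the chart c                                          *)
Definition jac c c' x : 'M[R]_n :=
  jacobian (fun y => coord c' (param c y)) (coord c x).

Definition smooth_function (f : X -> R) : Prop :=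
  forall c, smooth_on (chart_image c) (fun y => f (param c y)).

(* A tensor field is a family of component functions, one for each chart,      *)
(* obeying the transformation law; components off the domain of the chart are  *)
(* irrelevant.  This is a field of matrices of endomorphisms or bilinear forms.*)
Definition matrix_field := chart A -> X -> 'M[R]_n.

Definition smooth_matrix_field (T : matrix_field) : Prop :=
  forall c (i j : 'I_n),
    smooth_on (chart_image c) (fun y => T c (param c y) i j).

(* v *m J c x are the components of J v *)
Definition almost_complex_structure (J : matrix_field) : Prop :=
  [/\ smooth_matrix_field J,
      (forall c c' x, dom c x -> dom c' x ->
         J c x *m jac c c' x = jac c c' x *m J c' x)
    & (forall c x, dom c x -> J c x *m J c x = - 1%:M)].

(* g(u, v) = u *m g c x *m v^T *)
Definition riemannian_metric (g : matrix_field) : Prop :=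
  [/\ smooth_matrix_field g,
      (forall c c' x, dom c x -> dom c' x ->
         g c x = jac c c' x *m g c' x *m (jac c c' x)^T),
      (forall c x, dom c x -> (g c x)^T = g c x)
    & (forall c x, dom c x -> forall v : 'rV[R]_n,
         v != 0 -> 0 < (v *m g c x *m v^T) 0 0)].

Definition hermitian_metric (J g : matrix_field) : Prop :=
  riemannian_metric g /\
  (forall c x, dom c x -> J c x *m g c x *m (J c x)^T = g c x).

(* the matrix of omega(u, v) = g(J u, v) *)
Definition fundamental_form (J g : matrix_field) : matrix_field :=
  fun c x => J c x *m g c x.

(* Complex k-forms: the argument is the matrix whose rows are the components   *)
(* of k complexified tangent vectors.                                          *)
Definition form (k : nat) := chart A -> X -> 'M[R[i]]_(k, n) -> R[i].

Definition eq_form k (a b : form k) : Prop :=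
  forall c x, dom c x -> forall v, a c x v = b c x v.

Definition zero_form k : form k := fun _ _ _ => 0.

Definition add_form k (a b : form k) : form k :=
  fun c x v => a c x v + b c x v.

Definition multilinear k (f : 'M[R[i]]_(k, n) -> R[i]) : Prop :=
  forall (i : 'I_k) (u v w : 'M[R[i]]_(k, n)) (a b : R[i]),
    row i u = a *: row i v + b *: row i w ->
    row' i v = row' i u -> row' i w = row' i u ->
    f u = a * f v + b * f w.

Definition alternating k (f : 'M[R[i]]_(k, n) -> R[i]) : Prop :=
  forall (i j : 'I_k) (v : 'M[R[i]]_(k, n)),
    i != j -> row i v = row j v -> f v = 0.

Definition cmx (m : nat) (M : 'M[R]_(m, n)) : 'M[R[i]]_(m, n) :=
  map_mx (fun r : R => r%:C) M.

Definition smooth_form k (a : form k) : Prop :=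
  [/\ (forall c x, dom c x -> multilinear (a c x) /\ alternating (a c x)),
      (forall c c' x, dom c x -> dom c' x ->
         forall v, a c x v = a c' x (v *m cmx (jac c c' x)))
    & (forall c v, csmooth_on (chart_image c) (fun y => a c (param c y) v))].

(* Exterior derivative:                                                        *)
(*   da(v_0, .., v_k) = \sum_i (-1)^i v_i (a(v_0, .., v_i omitted, .., v_k))   *)
(* for vector fields with constant components in the chart.                    *)
Definition ext_d k (a : form k) : form k.+1 :=
  fun c x v =>
    \sum_(i < k.+1) (-1) ^+ i * \sum_(j < n) v i j *
      cpartial j (fun y => a c (param c y) (row' i v)) (coord c x).

(* Projections of the complexified tangent space onto T^{1,0} = {J v = i v}    *)
(* and T^{0,1} = {J v = - i v}, for J an almost complex structure.             *)
Definition proj10 (J : 'M[R]_n) : 'M[R[i]]_n :=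
  2^-1 *: (1%:M - 'i%C *: cmx J).
Definition proj01 (J : 'M[R]_n) : 'M[R[i]]_n :=
  2^-1 *: (1%:M + 'i%C *: cmx J).

(* Forms of bidegree (p, q) have degree q + p, in this order because           *)
(* q.+1 + p is convertible to (q + p).+1.  The (p, q) component is             *)
(*   a(v_1, .., v_k) |-> \sum_S a(P_S v_1, .., P_S v_k)                        *)
(* where S selects the p arguments that are projected to T^{1,0}, the others   *)
(* being projected to T^{0,1}.                                                 *)
Definition bidegree_part (J : matrix_field) (p q : nat) (a : form (q + p)) :
    form (q + p) :=
  fun c x v =>
    \sum_(S : {set 'I_(q + p)} | #|S| == p)
      a c x (\matrix_i (row i v *m
               (if i \in S then proj10 (J c x) else proj01 (J c x)))).

(* A^{p,q}(X) *)
Definition Apq (J : matrix_field) (p q : nat) (a : form (q + p)) : Prop :=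
  smooth_form a /\ eq_form (bidegree_part J a) a.

Definition dbar (J : matrix_field) (p q : nat) (a : form (q + p)) :
    form (q.+1 + p) :=
  @bidegree_part J p q.+1 (ext_d a).

(* The pointwise Hermitian product of k-forms,                                 *)
(*   1/k! \sum_(I, L) g^{I_1 L_1} .. g^{I_k L_k} a_{I_1 .. I_k} conj b_{L_1 .. L_k},*)
(* computed in the chart c.                                                    *)
Definition inner (g : matrix_field) k (a b : form k) c x : R[i] :=
  (k`!%:R)^-1 *
  \sum_(I : {ffun 'I_k -> 'I_n}) \sum_(L : {ffun 'I_k -> 'I_n})
    (\prod_(s < k) invmx (g c x) (I s) (L s))%:C *
    a c x (\matrix_s delta_mx 0 (I s)) *
    (b c x (\matrix_s delta_mx 0 (L s)))^*%C.

Record partition_of_unity := PartitionOfUnity {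
  pu_size : nat;
  pu_chart : 'I_pu_size -> chart A;
  pu_fun : 'I_pu_size -> X -> R;
  pu_continuous : forall i, continuous (pu_fun i);
  pu_ge0 : forall i x, 0 <= pu_fun i x;
  pu_compact : forall i, compact (closure [set x | pu_fun i x != 0]);
  pu_support : forall i,
    closure [set x | pu_fun i x != 0] `<=` dom (pu_chart i);
  pu_sum : forall x, \sum_(i < pu_size) pu_fun i x = 1
}.

(* Integral of the density with component h c in the chart c, through a chosen *)
(* finite partition of unity (there is one when X is compact Hausdorff, and    *)
(* the value does not depend on it).                                           *)
Definition integral_density (h : chart A -> X -> R) : R :=
  match pselect (inhabited partition_of_unity) with
  | left e =>
      let P := inhabited_witness e in
      \sum_(i < pu_size P)
        integral_Rn (fun y =>
          \1_(chart_image (pu_chart i)) y *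
          (pu_fun i (param (pu_chart i) y) *
           h (pu_chart i) (param (pu_chart i) y)))
  | right _ => 0
  end.

(* \int_X <a, b> dvol_g, where dvol_g has density sqrt (det g) in each chart *)
Definition L2_product (g : matrix_field) k (a b : form k) : R[i] :=
  let h c x : R[i] := inner g a b c x * (Num.sqrt (\det (g c x)))%:C in
  integral_density (fun c x => complex.Re (h c x)) +i*
  integral_density (fun c x => complex.Im (h c x)).

(* The graph of the formal adjoint dbar^* : A^{p,q+1} -> A^{p,q}, and the      *)
(* graph of the Laplacian.  The adjoint property determines dbar^* b, up to    *)
(* components off the domains of the charts.                                   *)
Definition dbar_star_graph (J g : matrix_field) (p q : nat)
    (b : form (q.+1 + p)) (b' : form (q + p)) : Prop :=
  [/\ @Apq J p q.+1 b, Apq J b'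
    & forall a : form (q + p), Apq J a ->
        L2_product g (dbar J a) b = L2_product g a b'].

(* e = dbar (dbar^* a); by convention dbar^* = 0 on A^{p,0} *)
Definition dbar_dbar_star_graph (J g : matrix_field) (p q : nat) :
    form (q + p) -> form (q + p) -> Prop :=
  match q return form (q + p) -> form (q + p) -> Prop with
  | 0%N => fun _ e => eq_form e (@zero_form p)
  | q'.+1 => fun a e => exists b : form (q' + p),
      @dbar_star_graph J g p q' a b /\ eq_form e (dbar J b)
  end.

(* e = dbar (dbar^* a) + dbar^* (dbar a) *)
Definition dbar_laplacian_graph (J g : matrix_field) (p q : nat)
    (a e : form (q + p)) : Prop :=
  exists e1 e2 : form (q + p),
    [/\ dbar_dbar_star_graph J g a e1,
        dbar_star_graph J g (dbar J a) e2
      & eq_form e (add_form e1 e2)].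

Definition harmonic (J g : matrix_field) (p q : nat) : set (form (q + p)) :=
  [set a | Apq J a /\ dbar_laplacian_graph J g a (@zero_form (q + p))].

Definition lin_indep k (m : nat) (a : 'I_m -> form k) : Prop :=
  forall l : 'I_m -> R[i],
    eq_form (fun c x v => \sum_(i < m) l i * a i c x v) (@zero_form k) ->
    forall i, l i = 0.

(* complex dimension, in nat or +oo *)
Definition cdim k (V : set (form k)) : \bar R :=
  ereal_sup [set (m%:R : R)%:E | m in
    [set m : nat | exists a : 'I_m -> form k,
       (forall i, V (a i)) /\ lin_indep a]].

(* h^{p,q}_{dbar, omega}, for the Hermitian metric g with fundamental form omega *)
Definition hodge_number (J g : matrix_field) (p q : nat) : \bar R :=
  cdim (@harmonic J g p q).

End Manifold.

(* Main.v *)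
Require Import Defs.
From mathcomp Require Import all_boot all_order all_algebra complex.
From mathcomp Require Import all_classical all_reals all_analysis.
Import Order.TTheory GRing.Theory Num.Theory.
Import numFieldNormedType.Exports.
Local Open Scope classical_set_scope.
Local Open Scope ring_scope.
Local Open Scope complex_scope.

(* If a is harmonic for g, pairing the equation with a gives
   |dbar a|^2 + |dbar^* a|^2 = 0, so that dbar a = 0 and a is L^2-orthogonal to
   the image of dbar.  The first condition does not involve the metric and, in
   real dimension 4, the second one only depends on its conformal class, because
   the L^2 product of 2-forms does.  Hence the spaces of harmonic (1,1)-forms of
   conformal metrics coincide.  That L^2 products are positive definite follows
   from bounding the iterated integral of a nonnegative function that is positive
   at a point from below by that of a multiple of the indicator of a cube. *)

(* Without the measurability required by [ge0_le_integral]: the inner integrals of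
   [integral_Rn] are not known to be measurable functions of the outer variable. *)
Lemma ge0_le_integralT d (T : measurableType d) (R : realType)
    (mu : {measure set T -> \bar R}) (f g : T -> \bar R) :
  (forall x, 0 <= f x)%E -> (forall x, f x <= g x)%E ->
  (\int[mu]_x f x <= \int[mu]_x g x)%E.
Proof.
move=> f0 fg; rewrite !ge0_integralTE//; last first.
  by move=> x; exact: le_trans (f0 x) (fg x).
apply: le_ereal_sup => _ [h hf <-]; exists h => // x.
exact: le_trans (hf x) (fg x).
Qed.

(** * Two-sided bounds for iterated Lebesgue integrals *)

Section IteratedIntegral.
Context {R : realType}.
Local Notation mu := (@lebesgue_measure R).

Lemma integral_step (k a b : R) : 0 <= k -> a <= b ->
  (\int[mu]_x (k * \1_`[a, b]%classic x)%:E)%E = (k * (b - a))%:E.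
Proof.
move=> k0 ab.
have := @integralZl_indic _ _ R mu _ measurableT (fun=> `[a, b]%classic) k.
move=> -> //; first last.
  by move=> /(le_lt_trans k0); rewrite ltxx.
rewrite integral_indic// setIT/= lebesgue_measure_itv/= lte_fin.
case: ltP => [//|ba]; have -> : a = b by apply/eqP; rewrite eq_le ab.
by rewrite mule0 subrr mulr0.
Qed.

(** The upper bound also serves the lower one: [Rintegral] applies [fine], which sends an infinite
    integral to 0, so finiteness must be known before the lower bound can pass to real numbers. *)
Lemma Rintegral_step_bounds (F : R -> R) (e a b k c d : R) :
  0 <= e -> a <= b -> 0 <= k -> c <= d ->
  (forall t, e * \1_`[a, b]%classic t <= F t <= k * \1_`[c, d]%classic t) ->
  e * (b - a) <= Rintegral mu setT F <= k * (d - c).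
Proof.
move=> e0 ab k0 cd H.
have F0 t : 0 <= e * \1_`[a, b]%classic t :> R by rewrite mulr_ge0.
have lo : ((e * (b - a))%:E <= \int[mu]_x (F x)%:E)%E.
  rewrite -integral_step//; apply: ge0_le_integralT => t; rewrite lee_fin//.
  by have /andP[] := H t.
have hi : (\int[mu]_x (F x)%:E <= (k * (d - c))%:E)%E.
  rewrite -integral_step//; apply: ge0_le_integralT => t; rewrite lee_fin;
    have /andP[H1 H2] := H t => //; exact: le_trans (F0 t) H1.
have fin : (\int[mu]_x (F x)%:E)%E \is a fin_num.
  rewrite fin_numElt (lt_le_trans _ lo) ?ltNyr//= (le_lt_trans hi)// ltry//.
by rewrite -!lee_fin /Rintegral fineK// lo hi.
Qed.

(** Negation exchanges the positive and negative parts. If both have finite integrals the difference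
    changes sign; in all other cases [fine] gives 0 on both sides. *)
Lemma RintegralN (F : R -> R) :
  Rintegral mu setT (fun t => - F t) = - Rintegral mu setT F.
Proof.
pose G := EFin \o F.
rewrite /Rintegral (_ : (fun t => (- F t)%:E) = \- G)%E// -/G.
rewrite [in LHS]integralE [in RHS]integralE funenegN funeposN.
have : (0 <= \int[mu]_x G^\+ x)%E by apply: integral_ge0.
have : (0 <= \int[mu]_x G^\- x)%E by apply: integral_ge0.
case: (\int[mu]_x G^\+ x)%E => [p| |] //;
  case: (\int[mu]_x G^\- x)%E => [q| |] //= _ _; rewrite ?oppr0//.
by rewrite opprB.
Qed.

Lemma integral_RnN n (f : 'rV[R]_n -> R) :
  integral_Rn (fun y => - f y) = - integral_Rn f.
Proof.
elim: n f => [//|n IHn] f /=.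
by rewrite -RintegralN; congr Rintegral; apply/funext => t; rewrite IHn.
Qed.

Lemma integral_Rn_ge0 n (f : 'rV[R]_n -> R) :
  (forall y, 0 <= f y) -> 0 <= integral_Rn f.
Proof.
elim: n f => [|n IHn] f f0 /=; first exact: f0.
by apply: Rintegral_ge0 => t _; exact: IHn.
Qed.

Lemma integral_Rn0 n : integral_Rn (fun _ : 'rV[R]_n => 0) = 0.
Proof.
elim: n => [//|n IHn] /=.
by rewrite IHn /Rintegral integral0.
Qed.

(** The two bounds are proved together by induction on the dimension: as a function of the outer
    variable, the inner integral lies between multiples of the indicators of two intervals, and the
    upper one keeps the next integral finite. *)
Lemma integral_Rn_box_bounds n (f : 'rV[R]_n -> R) (y0 : 'rV[R]_n)
    (e d k B : R) :
  0 <= e -> 0 <= d -> 0 <= k -> 0 <= B ->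
  (forall y, 0 <= f y <= k) ->
  (forall (y : 'rV[R]_n) j, B < `|y 0 j| -> f y = 0) ->
  (forall y : 'rV[R]_n, (forall j, `|y 0 j - y0 0 j| <= d) -> e <= f y) ->
  e * (d *+ 2) ^+ n <= integral_Rn f <= k * (B *+ 2) ^+ n.
Proof.
move=> e0 d0 k0 B0; elim: n f y0 e k e0 k0 => [|n IHn] f y0 e k e0 k0 fk fB fe.
  rewrite !expr0 !mulr1 /=; have /andP[_ ->] := fk 0.
  by rewrite fe// => -[].
rewrite /= !exprSr !mulrA.
set r := fun t (v : 'rV[R]_n) => row_mx (t%:M : 'rV[R]_1) v.
have r0 t v : r t v 0 ord0 = t.
  by rewrite /r mxE; case: splitP => // i _; rewrite (ord1 i) mxE eqxx.
have rS t v j : r t v 0 (lift ord0 j) = v 0 j.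
  rewrite /r mxE; case: splitP => [[[]]//|i /= ji]; congr (v 0 _).
  by apply/val_inj/esym; apply: (@addnI 1).
set s := y0 0 ord0.
have -> : d *+ 2 = (s + d) - (s - d) by rewrite opprB addrC addrA addrNK mulr2n.
have -> : B *+ 2 = B - - B by rewrite opprK mulr2n.
apply: Rintegral_step_bounds => [| | | |t].
- by rewrite mulr_ge0// exprn_ge0// opprB addrC addrA addrNK addr_ge0.
- by rewrite lerD2l ge0_cp.
- by rewrite mulr_ge0// exprn_ge0// opprK addr_ge0.
- by rewrite ge0_cp.
have fk' v : 0 <= f (r t v) <= k by [].
have fB' (v : 'rV_n) j : B < `|v 0 j| -> f (r t v) = 0.
  by rewrite -(rS t) => /fB.
have := IHn (fun v => f (r t v)) (\row_j y0 0 (lift ord0 j)).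
rewrite !indicE !mem_setE !in_itv/=.
rewrite (_ : (s + d) - (s - d) = d *+ 2); last first.
  by rewrite opprB addrC addrA addrNK mulr2n.
rewrite (_ : B - - B = B *+ 2); last by rewrite opprK mulr2n.
move=> {}IHn; apply/andP; split.
  have [|_] := boolP (s - d <= t <= s + d); last first.
    by rewrite mulr0 integral_Rn_ge0// => v; case/andP: (fk' v).
  rewrite -ler_distlC => st; rewrite mulr1.
  have H (v : 'rV_n) :
      (forall j, `|v 0 j - (\row_j y0 0 (lift ord0 j)) 0 j| <= d) ->
      e <= f (r t v).
    move=> H; apply: fe => j; case: (unliftP ord0 j) => [i|] ->.
      by rewrite rS; have := H i; rewrite mxE.
    by rewrite r0 distrC.
  by have /andP[] := IHn e k e0 k0 fk' fB' H.
(* Here [t] may be far from [s], where [f] has no positive lower bound; the induction hypothesis is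
   taken with [e = 0] and only its upper half is kept. *)
have [_|] := boolP (- B <= t <= B); first rewrite mulr1.
  have H (v : 'rV_n) :
      (forall j, `|v 0 j - (\row_j y0 0 (lift ord0 j)) 0 j| <= d) ->
      0 <= f (r t v) by case/andP: (fk' v).
  by have /andP[] := IHn 0 k (lexx _) k0 fk' fB' H.
rewrite -ler_norml -ltNge => Bt; rewrite mulr0.
rewrite (_ : (fun v => f _) = fun=> 0) ?integral_Rn0//.
by apply/funext => v; apply: (fB _ ord0); rewrite r0.
Qed.

(** If [f y] were positive, [f] would be at least [f y / 2] on a cube around [y], and the integral
    would be positive. Continuity is asked at [y] alone, so nothing has to be shown about a cut-off
    integrand at the edge of a chart image. *)
Lemma integral_Rn_eq0 n (f : 'rV[R]_n -> R) (k B : R) :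
  (forall y, 0 <= f y <= k) ->
  (forall (y : 'rV[R]_n) j, B < `|y 0 j| -> f y = 0) ->
  integral_Rn f = 0 ->
  forall y, {for y, continuous f} -> f y = 0.
Proof.
move=> fk fB f0 y cf; apply/eqP; rewrite eq_le.
have /andP[-> _] := fk y; rewrite andbT leNgt; apply/negP => fy.
have fy2 : 0 < f y / 2 by rewrite divr_gt0.
have : \forall z \near y, f y / 2 <= f z.
  move/cvgr_ge : cf; apply.
  by rewrite ltr_pdivrMr// mulr_natr mulr2n ltrDl.
move=> /nbhs_ballP[d /= d0 yd].
have k0 : 0 <= k by have /andP[y0 yk] := fk y; exact: le_trans y0 yk.
have B0 : 0 <= Num.max B 0 by rewrite le_max lexx orbT.
have fB' (z : 'rV_n) j : Num.max B 0 < `|z 0 j| -> f z = 0.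
  by rewrite gt_max => /andP[/fB].
(* Balls of row vectors are open cubes for the sup norm; halving the radius makes room for a closed
   cube. *)
have H (z : 'rV_n) : (forall j, `|z 0 j - y 0 j| <= d / 2) -> f y / 2 <= f z.
  move=> zy; apply: yd; rewrite -ball_normE/=.
  rewrite (le_lt_trans (y := d / 2))//; last first.
    by rewrite ltr_pdivrMr// mulr_natr mulr2n ltrDl.
  rewrite [leLHS]mx_normrE; apply: bigmax_le => [|[i j] _].
    by rewrite divr_ge0// ltW.
  by rewrite ord1 !mxE distrC.
have d2 : 0 <= d / 2 by rewrite divr_ge0// ltW.
have := integral_Rn_box_bounds _ _ _ _ _ _ _ (ltW fy2) d2 k0 B0 fk fB' H.
by rewrite f0 leNgt mulr_gt0// exprn_gt0// pmulrn_lgt0// divr_gt0.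
Qed.

End IteratedIntegral.

(** * Positive definite matrices and tensor powers *)

(** Symmetric Gaussian elimination: [al] is a positive pivot, [L] clears its row and column, and the
    induction continues with the Schur complement [S]. The pivot is normalised by its square
    root. *)
Lemma posdef_congr_id (F : rcfType) n (g : 'M[F]_n) :
  g^T = g -> (forall v : 'rV[F]_n, v != 0 -> 0 < (v *m g *m v^T) 0 0) ->
  exists C : 'M[F]_n, C *m g *m C^T = 1%:M.
Proof.
elim: n g => [|n IHn] g gT gpos; first by exists 0; apply/matrixP => -[].
pose h : 'M[F]_(1 + n) := g.
pose al := h 0 0; pose b := ursubmx h; pose D := drsubmx h.
have al0 : 0 < al.
  have := gpos (delta_mx 0 0); rewrite trmx_delta -rowE -colE !mxE; apply.
  by apply/eqP => /matrixP/(_ 0 0); rewrite !mxE !eqxx => /eqP; rewrite oner_eq0.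
have hE : h = block_mx al%:M b b^T D.
  rewrite -[h]submxK -/b -/D; congr block_mx.
    by apply/matrixP => i j; rewrite !ord1 !mxE eqxx /al; congr (h _ _); exact/val_inj.
  by rewrite trmx_ursub (gT : h^T = h).
pose S := D - al^-1 *: (b^T *m b).
pose L : 'M[F]_(1 + n) := block_mx 1%:M 0 (- al^-1 *: b^T) 1%:M.
have LhL : L *m h *m L^T = block_mx al%:M 0 0 S.
  rewrite hE /L tr_block_mx !mulmx_block !trmx1 !trmx0.
  rewrite !mul1mx !mulmx1 !mul0mx !mulmx0 !addr0 linearZ/= trmxK.
  rewrite -scalemxAl mul_mx_scalar scalerA mulNr mulVf ?gt_eqF// scaleN1r addNr.
  rewrite mul0mx !add0r mul_scalar_mx scalerA mulrN mulfV ?gt_eqF// scaleN1r addNr.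
  by rewrite -scalemxAl scaleNr addrC.
have ST : S^T = S.
  have := congr1 trmx LhL; rewrite !trmx_mul trmxK (gT : h^T = h) mulmxA LhL.
  by rewrite tr_block_mx => /eq_block_mx[_ _ _ /esym].
(* The value of [S] at [w] is that of [g] at [v *m L], whose last block is still [w], so that this
   vector is nonzero. *)
have Spos (w : 'rV_n) : w != 0 -> 0 < (w *m S *m w^T) 0 0.
  move=> w0; pose v : 'rV_(1 + n) := row_mx 0 w.
  have -> : w *m S *m w^T = v *m L *m h *m (v *m L)^T.
    rewrite trmx_mul -!mulmxA (mulmxA h) (mulmxA L) (mulmxA L) LhL /v.
    rewrite tr_row_mx [RHS]mulmxA mul_row_block mul_row_col.
    by rewrite !mul0mx !mulmx0 !add0r mulmxA trmx0 mulmx0 add0r.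
  apply: gpos; apply: contraNneq w0 => vL0.
  have : v *m L = 0 by [].
  rewrite /v /L mul_row_block mul0mx !mulmx1 mulmx0 !add0r -row_mx0.
  by move=> /eq_row_mx[_ ->].
have [C' C'S] := IHn S ST Spos.
pose M : 'M[F]_(1 + n) := block_mx (Num.sqrt al)^-1%:M 0 0 C'.
have MM : M *m (block_mx al%:M 0 0 S *m M^T) = 1%:M.
  rewrite /M tr_block_mx !trmx0 !mulmx_block !mul0mx !mulmx0 !addr0 !add0r ?mulmx0.
  rewrite (mulmxA C') C'S tr_scalar_mx -!scalar_mxM.
  rewrite (_ : _^-1 * _ = 1) -?scalar_mx_block//.
  rewrite -{2}(sqr_sqrtr (ltW al0)) expr2 mulfK ?mulVf//;
    by rewrite gt_eqF// sqrtr_gt0.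
exists (M *m L).
rewrite trmx_mul -!mulmxA (mulmxA g) (mulmxA L) (mulmxA L) LhL.
exact: MM.
Qed.

Lemma congr_idE (F : fieldType) n (C g : 'M[F]_n) : C *m g *m C^T = 1%:M ->
  [/\ C \in unitmx, g \in unitmx & invmx g = C^T *m C].
Proof.
move=> CgC; have := CgC; rewrite -mulmxA => /mulmx1_unit[Cu].
rewrite unitmx_mul unitmx_tr => /andP[gu _]; split=> //.
apply: (can_inj (mulKmx gu)); rewrite mulmxV//.
have : C^T *m (C *m g) = 1%:M by exact: mulmx1C.
by rewrite mulmxA => /mulmx1C.
Qed.

Lemma conjcMr (R : rcfType) (r : R) (z : R[i]) : (r%:C * z)^*%C = r%:C * z^*%C.
Proof. by case: z => u v /=; simpc. Qed.

Section TensorPower.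
Context {R : realType} {n k : nat}.
Implicit Types (C : 'M[R]_n) (a : {ffun 'I_k -> 'I_n} -> R[i]).

(** The right side is the squared norm of the image of [a] under the k-th tensor power of [C]. Once
    the squares are expanded, the sum over [K] factors slot by slot into entries of [C^T *m C]. *)
Lemma gram_tensor_sqr C a :
  \sum_(I : {ffun 'I_k -> 'I_n}) \sum_(L : {ffun 'I_k -> 'I_n})
    (\prod_(s < k) (C^T *m C) (I s) (L s))%:C * a I * (a L)^*%C =
  \sum_(K : {ffun 'I_k -> 'I_n})
    `|\sum_(I : {ffun 'I_k -> 'I_n})
        (\prod_(s < k) C (K s) (I s))%:C * a I| ^+ 2.
Proof.
under [RHS]eq_bigr => K _.
  rewrite sqr_normc mulr_suml rmorph_sum/=.
  under eq_bigr do rewrite mulr_sumr.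
  over.
rewrite [RHS]exchange_big/=; apply: eq_bigr => I _.
rewrite [RHS]exchange_big/=; apply: eq_bigr => L _.
under [RHS]eq_bigr => K _ do
  rewrite conjcMr mulrACA -rmorphM -big_split.
rewrite -mulr_suml -rmorph_sum -mulrA; congr (_%:C * _).
rewrite -(bigA_distr_bigA (fun s j => C j (I s) * C j (L s))).
by apply: eq_bigr => s _; rewrite mxE; apply: eq_bigr => j _; rewrite mxE.
Qed.

(** The tensor power of [C] is inverted by the tensor power of [invmx C]. *)
Lemma tensor_unit_eq0 C a : C \in unitmx ->
  (forall K : {ffun 'I_k -> 'I_n}, \sum_(I : {ffun 'I_k -> 'I_n})
      (\prod_(s < k) C (K s) (I s))%:C * a I = 0) ->
  forall I, a I = 0.
Proof.
move=> Cu a0 L.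
have : \sum_(K : {ffun 'I_k -> 'I_n}) (\prod_(s < k) invmx C (L s) (K s))%:C *
    (\sum_(I : {ffun 'I_k -> 'I_n}) (\prod_(s < k) C (K s) (I s))%:C * a I) = 0.
  by apply: big1 => K _; rewrite a0 mulr0.
under eq_bigr do rewrite mulr_sumr.
rewrite exchange_big/=.
under eq_bigr => I _.
  under eq_bigr do rewrite mulrA -rmorphM -big_split/=.
  rewrite -mulr_suml -rmorph_sum/=.
  rewrite -(bigA_distr_bigA (fun s j => invmx C (L s) j * C j (I s))).
  (* A product over the slots of entries of the identity matrix is the Kronecker symbol of the two
     multi-indices. *)
  rewrite (_ : \prod_s _ = (I == L)%:R); last first.
    transitivity (\prod_s (1%:M : 'M[R]_n) (L s) (I s)).
      by apply: eq_bigr => s _; rewrite -(mulVmx Cu) mxE.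
    have [->|IL] := eqVneq I L; first by apply: big1 => s _; rewrite mxE eqxx.
    have [s sIL] : exists s, L s != I s.
      apply/existsP; apply: contraNT IL; rewrite negb_exists => /forallP IL.
      by apply/eqP/ffunP => s; apply/esym/eqP; rewrite -[_ == _]negbK IL.
    by rewrite (bigD1 s)//= mxE (negPf sIL) mul0r.
  over.
rewrite (bigD1 L)//= eqxx mul1r big1 ?addr0// => I /negPf ->.
by rewrite mul0r.
Qed.

End TensorPower.

(** * The pointwise Hermitian product of forms *)

Section Inner.
Context {R : realType} {n : nat} {X : topologicalType}.
Context {A : smooth_atlas R n X}.
Local Notation form := (Defs.form A).
Implicit Types (c : chart A) (x : X) (g : matrix_field A).

Lemma inner_herm g k (a b : form k) c x : (g c x)^T = g c x ->
  inner g b a c x = (inner g a b c x)^*%C.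
Proof.
move=> gT; have iT : (invmx (g c x))^T = invmx (g c x) by rewrite trmx_inv gT.
rewrite /inner rmorphM fmorphV rmorph_nat; congr (_ * _).
rewrite exchange_big rmorph_sum/=; apply: eq_bigr => I _.
rewrite rmorph_sum/=; apply: eq_bigr => L _.
rewrite [RHS]rmorphM [X in _ = _ * X]conjcK [X in _ = X * _]conjcMr mulrAC.
congr (_%:C * _ * _).
by apply: eq_bigr => s _; rewrite -[in LHS]iT mxE.
Qed.

Lemma innerN g k (a b b' : form k) c x :
  (forall v, b' c x v = - b c x v) -> inner g a b' c x = - inner g a b c x.
Proof.
move=> bb'; rewrite /inner -mulrN -sumrN; congr (_ * _); apply: eq_bigr => I _.
by rewrite -sumrN; apply: eq_bigr => L _; rewrite bb' rmorphN mulrN.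
Qed.

Lemma eq_inner g k (a a' b b' : form k) c x :
  (forall v, a c x v = a' c x v) -> (forall v, b c x v = b' c x v) ->
  inner g a b c x = inner g a' b' c x.
Proof.
move=> aa' bb'; congr (_ * _); apply: eq_bigr => I _.
by apply: eq_bigr => L _; rewrite aa' bb'.
Qed.

Lemma inner_eq0r g k (a b : form k) c x :
  (forall I : {ffun 'I_k -> 'I_n}, b c x (\matrix_s delta_mx 0 (I s)) = 0) ->
  inner g a b c x = 0.
Proof.
move=> b0; rewrite /inner big1 ?mulr0// => I _; rewrite big1// => L _.
by rewrite b0 conjc0 mulr0.
Qed.

Section PositiveDefinite.
Variables (g : matrix_field A) (c : chart A) (x : X).
Hypothesis gT : (g c x)^T = g c x.
Hypothesis gpos : forall v : 'rV[R]_n, v != 0 -> 0 < (v *m g c x *m v^T) 0 0.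

Lemma posdef_unitmx : g c x \in unitmx.
Proof. by have [C /congr_idE[]] := posdef_congr_id _ _ _ gT gpos. Qed.

Lemma posdef_det_gt0 : 0 < \det (g c x).
Proof.
have [C /[dup]/congr_idE[Cu gu _]] := posdef_congr_id _ _ _ gT gpos.
move=> /(congr1 determinant); rewrite !det_mulmx det_tr det1 mulrAC -expr2.
have C2 : 0 < \det C ^+ 2.
  by rewrite exprn_even_gt0//= -unitfE -unitmxE.
by move=> /(congr1 (fun t => 0 < t)); rewrite pmulr_rgt0// ltr01.
Qed.

Lemma inner_ge0 k (a : form k) : 0 <= inner g a a c x.
Proof.
have [C /congr_idE[_ _ gE]] := posdef_congr_id _ _ _ gT gpos.
rewrite /inner gE gram_tensor_sqr mulr_ge0 ?invr_ge0 ?ler0n//.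
by apply: sumr_ge0 => K _; rewrite exprn_ge0.
Qed.

(** With [invmx g] written as [C^T *m C], the product is a sum of squares. The conclusion concerns
    tuples of coordinate vectors, the only arguments that [inner] reads. *)
Lemma inner_definite k (a : form k) : inner g a a c x = 0 ->
  forall I : {ffun 'I_k -> 'I_n}, a c x (\matrix_s delta_mx 0 (I s)) = 0.
Proof.
have [C /congr_idE[Cu _ gE]] := posdef_congr_id _ _ _ gT gpos.
move=> /eqP; rewrite /inner gE gram_tensor_sqr mulf_eq0 invr_eq0 pnatr_eq0.
rewrite gtn_eqF ?fact_gt0//= psumr_eq0; last by move=> K _; rewrite exprn_ge0.
move=> /allP a0; apply: (tensor_unit_eq0 _ _ Cu) => K.
by have := a0 K (mem_index_enum K); rewrite /= sqrf_eq0 normr_eq0 => /eqP.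
Qed.

End PositiveDefinite.

End Inner.

(** * Integrals of nonnegative densities *)

Lemma compact_norm_le {R : realType} {T : topologicalType}
    {V : normedModType R} (K : set T)
    (u : T -> V) : compact K -> (forall x, K x -> {for x, continuous u}) ->
  exists B, forall x, K x -> `|u x| <= B.
Proof.
move=> cK cu.
have : {within K, continuous u}.
  by apply: continuous_in_subspaceT => x /set_mem /cu.
move=> /continuous_compact /(_ cK) /compact_bounded /pinfty_ex_gt0[B _ HB].
by exists B => x Kx; apply: HB; exists x.
Qed.

Lemma near_eq_continuous_at {T U : topologicalType} (f g : T -> U) (x : T) :
  (\forall z \near x, g z = f z) -> {for x, continuous g} ->
  {for x, continuous f}.
Proof.
move=> gf cg; rewrite /prop_for /continuous_at -(nbhs_singleton gf).
exact: cvg_trans (near_eq_cvg gf) cg.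
Qed.

Section Density.
Context {R : realType} {n : nat} {X : topologicalType}.
Context {A : smooth_atlas R n X}.
Implicit Types (c : chart A) (x : X) (h : chart A -> X -> R).

Definition pu_integral (P : partition_of_unity A) h : R :=
  \sum_(i < pu_size P)
    integral_Rn (fun y =>
      \1_(chart_image (pu_chart i)) y *
      (pu_fun i (param (pu_chart i) y) *
       h (pu_chart i) (param (pu_chart i) y))).

(** The partition of unity is chosen before the density, so one [P] serves all [h]. Both
    alternatives can be carried through the argument, with no appeal to the existence of partitions
    or to independence of the choice. *)
Lemma integral_densityE :
  (exists P, forall h, integral_density h = pu_integral P h) \/
  (forall h, integral_density h = 0).
Proof.
rewrite /integral_density; case: pselect => [e|_]; last by right.
by left; exists (inhabited_witness e).
Qed.

Lemma eq_pu_integral P h h' :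
  (forall (i : 'I_(pu_size P)) x, dom (pu_chart i) x ->
     pu_fun i x * h (pu_chart i) x = pu_fun i x * h' (pu_chart i) x) ->
  pu_integral P h = pu_integral P h'.
Proof.
move=> hh'; apply: eq_bigr => i _; congr integral_Rn; apply/funext => y.
rewrite indicE; have [|_] := boolP (y \in _); last by rewrite !mul0r.
by rewrite inE => -[x cx <-]; rewrite coordK// hh'.
Qed.

Lemma pu_integralN P h : pu_integral P (fun c x => - h c x) = - pu_integral P h.
Proof.
rewrite /pu_integral -sumrN; apply: eq_bigr => i _; rewrite -integral_RnN.
by congr integral_Rn; apply/funext => y; rewrite !mulrN.
Qed.

Section Nonnegative.
Variables (P : partition_of_unity A) (h : chart A -> X -> R).
Hypothesis h_ge0 : forall c x, dom c x -> 0 <= h c x.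

Let f (i : 'I_(pu_size P)) (y : 'rV[R]_n) : R :=
  \1_(chart_image (pu_chart i)) y *
  (pu_fun i (param (pu_chart i) y) * h (pu_chart i) (param (pu_chart i) y)).

Let f_ge0 i y : 0 <= f i y.
Proof.
rewrite /f indicE; have [|_] := boolP (y \in _); last by rewrite mul0r.
by rewrite inE => -[x cx <-]; rewrite coordK// mul1r mulr_ge0// ?pu_ge0// h_ge0.
Qed.

Lemma pu_integral_ge0 : 0 <= pu_integral P h.
Proof. by apply: sumr_ge0 => i _; exact: (integral_Rn_ge0 _ _ (f_ge0 i)). Qed.

Hypothesis h_continuous : forall c x, dom c x ->
  {for Defs.coord c x, continuous (fun y => h c (param c y))}.

(** The summands are nonnegative, so each vanishes. Each integrand is bounded with bounded support,
    because the support of [pu_fun i] is a compact subset of the chart domain, and [integral_Rn_eq0]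
    applies at the coordinates of the point. *)
Lemma pu_integral_eq0 : pu_integral P h = 0 ->
  forall (i : 'I_(pu_size P)) x, pu_fun i x != 0 -> h (pu_chart i) x = 0.
Proof.
move=> h0 i x0 pu0.
have {}h0 : integral_Rn (f i) = 0.
  by move: h0 => /psumr_eq0P; apply=> // j _; exact: (integral_Rn_ge0 _ _ (f_ge0 j)).
set c := pu_chart i; pose K := closure [set x | pu_fun i x != 0].
have suppK x : pu_fun i x != 0 -> K x by move=> ?; exact: subset_closure.
have Kdom x : K x -> dom c x by exact: pu_support.
have h_cts x : dom c x -> {for x, continuous (h c)}.
  move=> cx; have cts : {for x, continuous (fun x => h c (param c (Defs.coord c x)))}.
    apply: (@continuous_comp _ _ _ (Defs.coord c) (fun y => h c (param c y))).
      exact: Defs.coord_continuous.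
    exact: h_continuous.
  apply: near_eq_continuous_at cts.
  have : nbhs x (dom c) by apply: open_nbhs_nbhs; split => //; exact: dom_open.
  by apply: filterS => z /coordK ->.
(* [B] bounds the coordinates on the support, and [k] below bounds the integrand there. *)
have [B HB] := compact_norm_le K (Defs.coord c) (pu_compact (i := i))
  (fun x Kx => Defs.coord_continuous (Kdom x Kx)).
have F_cts x : K x -> {for x, continuous (fun x => pu_fun i x * h c x)}.
  by move=> /Kdom cx; apply: continuousM; [exact: pu_continuous|exact: h_cts].
have [k Hk] := compact_norm_le K _ (pu_compact (i := i)) F_cts.
have x0K := suppK _ pu0; have cx0 := Kdom _ x0K.
have k0 : 0 <= k by exact: le_trans (Hk _ x0K).
have f_le y : 0 <= f i y <= k.
  rewrite f_ge0/= /f indicE; have [|_] := boolP (y \in _); last by rewrite mul0r.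
  rewrite inE => -[x cx <-]; rewrite coordK// mul1r.
  have [->|/suppK Kx] := eqVneq (pu_fun i x) 0; first by rewrite mul0r.
  exact: le_trans (ler_norm _) (Hk _ Kx).
have f_supp (y : 'rV_n) j : B < `|y 0 j| -> f i y = 0.
  move=> By; rewrite /f indicE; have [|_] := boolP (y \in _); last by rewrite mul0r.
  rewrite inE => -[x cx xy]; rewrite -xy coordK// mul1r.
  have [->|/suppK Kx] := eqVneq (pu_fun i x) 0; first by rewrite mul0r.
  have := HB _ Kx; rewrite xy leNgt => /negP[]; apply: lt_le_trans By _.
  rewrite [leRHS]mx_normrE.
  exact: (le_bigmax _ (fun ij : 'I_1 * 'I_n => `|y ij.1 ij.2|) (0, j)).
have f_cts : {for Defs.coord c x0, continuous (f i)}.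
  have : {for Defs.coord c x0, continuous
      (fun y => pu_fun i (param c y) * h c (param c y))}.
    apply: continuousM; last exact: h_continuous.
    apply: (@continuous_comp _ _ _ (param c) (pu_fun i)).
      exact: param_continuous.
    exact: pu_continuous.
  apply: near_eq_continuous_at.
  have : nbhs (Defs.coord c x0) (chart_image c).
    by apply: open_nbhs_nbhs; split; [exact: image_open|exists x0].
  by apply: filterS => z cz; rewrite /f indicE mem_set// mul1r.
have := integral_Rn_eq0 _ _ _ _ f_le f_supp h0 _ f_cts.
have im : chart_image c (Defs.coord c x0) by exists x0.
rewrite /f indicE mem_set// -/c coordK// mul1r.
by move/eqP; rewrite mulf_eq0 (negPf pu0) => /eqP.
Qed.

End Nonnegative.
End Density.

(** * Continuity of the density of the [L^2] norm *)

Section ContinuousAt.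
Context {R : realType} {T : topologicalType} (y : T).

Lemma continuous_at_sum (I : finType) (F : I -> T -> R) :
  (forall i, {for y, continuous (F i)}) ->
  {for y, continuous (fun z => \sum_i F i z)}.
Proof.
by move=> cF; apply: cvg_big; [exact: add_continuous|move=> i _; exact: cF].
Qed.

Lemma continuous_at_prod (I : finType) (F : I -> T -> R) :
  (forall i, {for y, continuous (F i)}) ->
  {for y, continuous (fun z => \prod_i F i z)}.
Proof.
by move=> cF; apply: cvg_big; [exact: mul_continuous|move=> i _; exact: cF].
Qed.

Lemma continuous_at_det m (M : T -> 'M[R]_m) :
  (forall i j, {for y, continuous (fun z => M z i j)}) ->
  {for y, continuous (fun z => \det (M z))}.
Proof.
move=> cM; apply: continuous_at_sum => s.
apply: continuousM; first exact: cst_continuous.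
by apply: continuous_at_prod => i.
Qed.

(** By Cramer's rule. Invertibility is assumed on a neighbourhood because [invmx] returns a singular
    matrix unchanged. *)
Lemma continuous_at_invmx m (M : T -> 'M[R]_m) i j :
  (\forall z \near y, M z \in unitmx) ->
  (forall i j, {for y, continuous (fun z => M z i j)}) ->
  {for y, continuous (fun z => invmx (M z) i j)}.
Proof.
move=> Mu cM.
apply: (@near_eq_continuous_at _ _ _ (fun z => (\det (M z))^-1 * cofactor (M z) j i)).
  by apply: filterS Mu => z Mz; rewrite /invmx Mz !mxE.
apply: continuousM.
  apply: continuousV; last exact: continuous_at_det.
  by have := nbhs_singleton Mu; rewrite unitmxE unitfE.
apply: continuousM; first exact: cst_continuous.
apply: continuous_at_det => k l; apply: near_eq_continuous_at (cM (lift j k) (lift i l)).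
by apply: nearW => z; rewrite !mxE.
Qed.

(* R[i] carries no topology in the library, hence the componentwise definition. *)
Definition ccontinuous_at (f : T -> R[i]) :=
  {for y, continuous (fun z => complex.Re (f z))} /\
  {for y, continuous (fun z => complex.Im (f z))}.

Lemma ccontinuous_at_real (f : T -> R) :
  {for y, continuous f} -> ccontinuous_at (fun z => (f z)%:C).
Proof. by move=> cf; split => //; exact: cst_continuous. Qed.

Lemma ccontinuous_at_conj (f : T -> R[i]) :
  ccontinuous_at f -> ccontinuous_at (fun z => (f z)^*%C).
Proof.
move=> [cr ci]; split.
  by apply: near_eq_continuous_at cr; apply: nearW => z; case: (f z).
apply: near_eq_continuous_at (continuousN ci).
by apply: nearW => z /=; case: (f z).
Qed.

Lemma ccontinuous_atM (f g : T -> R[i]) :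
  ccontinuous_at f -> ccontinuous_at g -> ccontinuous_at (fun z => f z * g z).
Proof.
move=> [fr fi] [gr gi]; split.
  apply: (@near_eq_continuous_at _ _ _ (fun z =>
    complex.Re (f z) * complex.Re (g z) - complex.Im (f z) * complex.Im (g z))).
    by apply: nearW => z; case: (f z); case: (g z).
  exact: (continuousB (continuousM fr gr) (continuousM fi gi)).
apply: (@near_eq_continuous_at _ _ _ (fun z =>
  complex.Re (f z) * complex.Im (g z) + complex.Im (f z) * complex.Re (g z))).
  by apply: nearW => z; case: (f z); case: (g z).
exact: (continuousD (continuousM fr gi) (continuousM fi gr)).
Qed.

Lemma ccontinuous_at_sum (I : finType) (F : I -> T -> R[i]) :
  (forall i, ccontinuous_at (F i)) -> ccontinuous_at (fun z => \sum_i F i z).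
Proof.
move=> cF; split.
  apply: near_eq_continuous_at (continuous_at_sum _ _ (fun i => (cF i).1)).
  by apply: nearW => z; rewrite (raddf_sum (@complex.Re R)).
apply: near_eq_continuous_at (continuous_at_sum _ _ (fun i => (cF i).2)).
by apply: nearW => z; rewrite (raddf_sum (@complex.Im R)).
Qed.

End ContinuousAt.

Section L2Density.
Context {R : realType} {n : nat} {X : topologicalType}.
Context {A : smooth_atlas R n X}.
Local Notation form := (Defs.form A).

Lemma L2_density_continuous (g : matrix_field A) k (a : form k) c x :
  riemannian_metric g -> smooth_form a -> dom c x ->
  {for Defs.coord c x, continuous (fun y =>
     complex.Re (inner g a a c (param c y) *
                 (Num.sqrt (\det (g c (param c y))))%:C))}.
Proof.
move=> [gs _ gT gpos] [_ _ asm] cx.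
have im : chart_image c (Defs.coord c x) by exists x.
have cg i j : {for Defs.coord c x, continuous (fun y => g c (param c y) i j)}.
  by have [] := gs c i j [::] _ im.
have ca v : ccontinuous_at (Defs.coord c x) (fun y => a c (param c y) v).
  by have [r i] := asm c v; split; [have [] := r [::] _ im|have [] := i [::] _ im].
suff [] : ccontinuous_at (Defs.coord c x) (fun y =>
     inner g a a c (param c y) * (Num.sqrt (\det (g c (param c y))))%:C) by [].
apply: ccontinuous_atM.
  rewrite /inner; apply: ccontinuous_atM; first by split; exact: cst_continuous.
  apply: ccontinuous_at_sum => I; apply: ccontinuous_at_sum => L.
  apply: ccontinuous_atM; last exact: ccontinuous_at_conj.
  apply: ccontinuous_atM => //; apply: ccontinuous_at_real.
  apply: continuous_at_prod => s; apply: continuous_at_invmx => //.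
  (* The metric is known to be nondegenerate over the chart domain, and the chart image is a
     neighbourhood of the point because it is open. *)
  have : nbhs (Defs.coord c x) (chart_image c).
    by apply: open_nbhs_nbhs; split => //; exact: image_open.
  apply: filterS => _ [z cz <-]; rewrite coordK//.
  by apply: posdef_unitmx; [exact: gT|exact: gpos].
apply: ccontinuous_at_real.
apply: (@continuous_comp _ _ _ (fun y => \det (g c (param c y))) Num.sqrt).
  exact: continuous_at_det.
exact: sqrt_continuous.
Qed.

End L2Density.

(** * The zero form, later the value of [dbar^*] for the second metric *)

Section ZeroForm.
Context {R : realType} {n : nat} {X : topologicalType}.
Context {A : smooth_atlas R n X}.
Local Notation form := (Defs.form A).
Implicit Types (J g : matrix_field A).

Lemma iter_partial0 (s : seq 'I_n) :
  iter_partial s (fun _ : 'rV[R]_n => 0) = fun=> 0.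
Proof.
elim: s => [//|j s IHs] /=; rewrite /iter_partial /= in IHs *; rewrite IHs.
by apply/funext => y; rewrite /partial; exact: derive_cst.
Qed.

Lemma cpartial0 (j : 'I_n) (y : 'rV[R]_n) : cpartial j (fun=> 0) y = 0.
Proof.
have E : partial j (fun _ : 'rV[R]_n => 0) = fun=> 0 by exact: (iter_partial0 [:: j]).
by rewrite /cpartial /= E.
Qed.

Lemma smooth_on0 (U : set 'rV[R]_n) : smooth_on U (fun=> 0).
Proof.
move=> s y Uy; rewrite iter_partial0; split; first exact: cst_continuous.
by move=> j; exact: derivable_cst.
Qed.

Lemma bidegree_part0 J p q :
  bidegree_part J (@zero_form R n X A (q + p)) = @zero_form R n X A (q + p).
Proof. by apply/funext => c; apply/funext => x; apply/funext => v; exact: big1. Qed.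

Lemma dbar0 J p q :
  dbar J (@zero_form R n X A (q + p)) = @zero_form R n X A (q.+1 + p).
Proof.
rewrite /dbar (_ : ext_d _ = @zero_form R n X A (q.+1 + p)) ?bidegree_part0//.
apply/funext => c; apply/funext => x; apply/funext => v.
rewrite /ext_d big1// => i _; rewrite big1 ?mulr0// => j _.
by rewrite [cpartial _ _ _]cpartial0 mulr0.
Qed.

Lemma Apq0 J p q : Apq J (@zero_form R n X A (q + p)).
Proof.
split; last by rewrite bidegree_part0.
split => [c x _|//|c v]; last by split; exact: smooth_on0.
by split => // i u v w a b _ _ _; rewrite /zero_form !mulr0 addr0.
Qed.

End ZeroForm.

(** * Positivity and definiteness of the [L^2] product *)

Section L2Product.
Context {R : realType} {n : nat} {X : topologicalType}.
Context {A : smooth_atlas R n X}.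
Local Notation form := (Defs.form A).
Implicit Types (J g : matrix_field A).

Let density g {k} (a b : form k) c x : R[i] :=
  inner g a b c x * (Num.sqrt (\det (g c x)))%:C.

Let ReM (z : R[i]) (r : R) : complex.Re (z * r%:C) = complex.Re z * r.
Proof. by case: z => u v /=; rewrite mulr0 subr0. Qed.

Lemma L2_product_eq0 : (forall h : chart A -> X -> R, integral_density h = 0) ->
  forall g k (a b : form k), L2_product g a b = 0.
Proof. by move=> h0 g k a b; rewrite /L2_product !h0. Qed.

Variable P : partition_of_unity A.
Hypothesis PE : forall h : chart A -> X -> R, integral_density h = pu_integral P h.

(** Vanishing as far as [P] detects it: in the chart attached to each partition function, where that
    function is nonzero. A zero norm gives exactly this, and it kills all [L^2] products, so no
    change of charts is ever made. *)
Definition pu_null {k} (b : form k) :=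
  forall (i : 'I_(pu_size P)) x, pu_fun i x != 0 ->
  forall I : {ffun 'I_k -> 'I_n}, b (pu_chart i) x (\matrix_s delta_mx 0 (I s)) = 0.

(** As [pu_null] does not mention the metric, vanishing deduced from one metric can be used for the
    other. *)
Lemma L2_pu_null g k (a b : form k) : pu_null b -> L2_product g a b = 0.
Proof.
move=> b0.
have d0 (i : 'I_(pu_size P)) x :
    pu_fun i x != 0 -> density g a b (pu_chart i) x = 0.
  by move=> /b0 bi; rewrite /density inner_eq0r// mul0r.
rewrite /L2_product !PE.
rewrite (eq_pu_integral P _ (fun _ _ => 0)); last first.
  move=> i x _; have [->|/d0] := eqVneq (pu_fun i x) 0; first by rewrite !mul0r.
  by rewrite /density => ->.
rewrite [X in _ +i* X](eq_pu_integral P _ (fun _ _ => 0)); last first.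
  move=> i x _; have [->|/d0] := eqVneq (pu_fun i x) 0; first by rewrite !mul0r.
  by rewrite /density => ->.
suff -> : pu_integral P (fun _ _ => 0) = 0 by [].
rewrite /pu_integral big1// => i _; rewrite -[RHS](integral_Rn0 n).
by congr integral_Rn; apply/funext => y; rewrite !mulr0.
Qed.

Lemma Re_L2_product g k (a b : form k) :
  complex.Re (L2_product g a b) =
  pu_integral P (fun c x => complex.Re (density g a b c x)).
Proof. by rewrite /L2_product /= PE. Qed.

Lemma Re_L2_product_ge0 g k (a : form k) :
  riemannian_metric g -> 0 <= complex.Re (L2_product g a a).
Proof.
move=> [_ _ gT gpos]; rewrite Re_L2_product; apply: pu_integral_ge0 => c x cx.
rewrite ReM mulr_ge0// ?sqrtr_ge0//.
have := inner_ge0 g c x (gT c x cx) (gpos c x cx) k a.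
by rewrite lecE => /andP[].
Qed.

Lemma L2_definite g k (a : form k) : riemannian_metric g -> smooth_form a ->
  complex.Re (L2_product g a a) = 0 -> pu_null a.
Proof.
move=> gr asm; rewrite Re_L2_product => a0 i x pu0.
have [_ _ gT gpos] := gr.
have cx : dom (pu_chart i) x by apply: (pu_support (i := i)); exact: subset_closure.
have inner0 c z (cz : dom c z) := inner_ge0 g c z (gT c z cz) (gpos c z cz) k a.
apply: (inner_definite g _ _ (gT _ _ cx) (gpos _ _ cx)).
have := pu_integral_eq0 P _ _ _ a0 i x pu0.
rewrite ReM => H.
have /eqP : complex.Re (inner g a a (pu_chart i) x) *
    Num.sqrt (\det (g (pu_chart i) x)) = 0.
  apply: H => [c z cz|c z cz]; last exact: L2_density_continuous.
  rewrite ReM mulr_ge0// ?sqrtr_ge0//.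
  by have := inner0 c z cz; rewrite lecE => /andP[].
rewrite mulf_eq0 [X in _ || X]gt_eqF ?orbF; last first.
  by rewrite sqrtr_gt0; exact: posdef_det_gt0 (gT _ _ cx) (gpos _ _ cx).
(* Being nonnegative in [R[i]] includes having zero imaginary part. *)
move=> re0; apply/eqP; rewrite eq_complex re0/=.
by have := inner0 _ _ cx; rewrite lecE => /andP[].
Qed.

(** Hermitian symmetry exchanges the arguments up to conjugation, which the real part ignores.
    Moving a sign is the only linearity used, so additivity of iterated integrals never comes up. *)
Lemma Re_L2_product_anti g k (a b a' b' : form k) : riemannian_metric g ->
  eq_form b' (fun c x v => - a' c x v) -> eq_form b a ->
  complex.Re (L2_product g a b') = - complex.Re (L2_product g a' b).
Proof.
move=> [_ _ gT _] bb ba; rewrite !Re_L2_product -pu_integralN.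
apply: eq_pu_integral => i x cx; congr (_ * _); rewrite /density !ReM -mulNr.
congr (_ * _); rewrite (innerN g k a a' b' _ _ (bb _ _ cx)).
rewrite (eq_inner g k a' a' b a) ?(ba _ _ cx)//; last exact: ba.
by rewrite (inner_herm g k a a')//; [case: (inner _ _ _ _ _) | exact: gT].
Qed.

End L2Product.

(** * Conformal invariance of harmonic (1,1)-forms *)

Section Conformal.
Context {R : realType} {X : topologicalType} {A : smooth_atlas R 4 X}.
Local Notation form := (Defs.form A).
Variables (J g g' : matrix_field A) (Phi : X -> R).
Hypothesis g_metric : riemannian_metric g.
Hypothesis Phi_gt0 : forall x, 0 < Phi x.
Hypothesis conformal : forall c x, dom c x -> g' c x = Phi x *: g c x.

(* In dimension 4 the factor [Phi ^- 2] of the inner product of 2-forms cancels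
   the factor [Phi ^+ 2] of the volume density. *)
Lemma L2_product2_conformal (a b : form 2) : L2_product g' a b = L2_product g a b.
Proof.
have [_ _ gT gpos] := g_metric.
have E c x : dom c x -> inner g' a b c x * (Num.sqrt (\det (g' c x)))%:C =
    inner g a b c x * (Num.sqrt (\det (g c x)))%:C.
  move=> cx; have P0 := Phi_gt0 x; have Pn0 : Phi x != 0 by rewrite gt_eqF.
  have gu := posdef_unitmx g c x (gT _ _ cx) (gpos _ _ cx).
  have -> : Num.sqrt (\det (g' c x)) = Phi x ^+ 2 * Num.sqrt (\det (g c x)).
    rewrite conformal// detZ (exprM _ 2 2).
    by rewrite sqrtrM ?sqr_ge0// sqrtr_sqr ger0_norm// sqr_ge0.
  have -> : inner g' a b c x = (Phi x ^- 2)%:C * inner g a b c x.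
    rewrite /inner mulrCA; congr (_ * _); rewrite mulr_sumr.
    apply: eq_bigr => I _; rewrite mulr_sumr; apply: eq_bigr => L _.
    rewrite !mulrA; congr (_ * _ * _); rewrite -rmorphM; congr _%:C.
    rewrite conformal// invmxZ; last by rewrite unitmxZ// unitfE.
    under eq_bigr do rewrite mxE.
    by rewrite big_split/= prodr_const card_ord exprVn.
  by rewrite rmorphM mulrACA -rmorphM mulVf ?expf_neq0// rmorph1 mul1r.
rewrite /L2_product; case: (@integral_densityE R 4 X A) => [[P PE]|h0];
  last by rewrite !h0.
rewrite !PE; apply/eqP; rewrite eq_complex; apply/andP; split; apply/eqP;
  apply: eq_pu_integral => i x cx.
  by congr (_ * complex.Re _); exact: E.
by congr (_ * complex.Im _); exact: E.
Qed.

Lemma harmonic11_conformal :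
  @Defs.harmonic _ _ _ A J g 1 1 `<=` @Defs.harmonic _ _ _ A J g' 1 1.
Proof.
move=> a [aA] [e1 [e2 [[b [[_ bA Hb] e1E]] [daA e2A He2] e0]]].
pose z2 := @zero_form R 4 X A (1 + 1).
have z2A : Apq J z2 by exact: Apq0.
have zz : eq_form z2 (add_form z2 z2) by move=> c x _ v; rewrite /add_form addr0.
(* For [g'], both terms of the Laplacian will be zero separately. *)
split=> //; exists z2, z2.
have [[P PE]|h0] := @integral_densityE R 4 X A; last first.
  (* junk case: without a partition of unity, all L^2 products are 0 *)
  split; [|split=> [//|//|u _]|exact: zz]; last first.
    by rewrite (L2_product_eq0 h0 g' _ (dbar J u)) (L2_product_eq0 h0 g' _ u).
  exists (@zero_form R 4 X A (0 + 1)); split; last by rewrite dbar0.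
  split=> [//||u _]; first exact: Apq0.
  by rewrite (L2_product_eq0 h0 g' _ (dbar J u)) (L2_product_eq0 h0 g' _ u).
have b_ge0 := Re_L2_product_ge0 P PE g _ b g_metric.
have da_ge0 := Re_L2_product_ge0 P PE g _ (dbar J a) g_metric.
have e2N : eq_form e2 (fun c x v => - dbar J b c x v).
  move=> c x cx v; apply/eqP; rewrite -addr_eq0 addrC -(e1E _ _ cx v).
  by have := e0 c x cx v; rewrite /zero_form /add_form => <-.
(* With [b] standing for [dbar^* a], the adjunction for [e2] tested on [a] gives the product of [a]
   with [e2], and the one for [b] tested on [b] itself gives the product of [dbar J b] with [a];
   since [e2] is minus [dbar J b], their real parts are opposite. *)
have daN : complex.Re (L2_product g (dbar J a) (dbar J a)) =
    - complex.Re (L2_product g b b).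
  by rewrite He2// -Hb//; exact: (Re_L2_product_anti P PE).
have b0 : complex.Re (L2_product g b b) = 0.
  by apply/eqP; rewrite eq_le b_ge0 -oppr_ge0 -daN da_ge0.
have b_null : pu_null P b by exact: (L2_definite P PE g _ b g_metric bA.1 b0).
have da_null : pu_null P (dbar J a).
  by apply: (L2_definite P PE g _ _ g_metric daA.1); rewrite daN b0 oppr0.
have z_null k : pu_null P (@zero_form R 4 X A k) by [].
split; [|split=> [//|//|u _]|exact: zz]; last first.
  rewrite (L2_pu_null P PE g' _ (dbar J u) _ da_null).
  by rewrite (L2_pu_null P PE g' _ u _ (z_null _)).
exists (@zero_form R 4 X A (0 + 1)); split; last by rewrite dbar0.
split=> [//||u uA]; first exact: Apq0.
rewrite (L2_pu_null P PE g' _ u _ (z_null _)).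
(* [dbar J u] and [a] are 2-forms, so their product may be computed with [g], where the adjunction
   turns it into a product with the null form [b]. *)
transitivity (L2_product g (dbar J u) a); first exact: L2_product2_conformal.
by rewrite (Hb _ uA) (L2_pu_null P PE g _ u _ b_null).
Qed.

End Conformal.

(** Multiplying by [J] once more recovers the metric up to sign, since [J] squares to -1. *)
Lemma fundamental_form_inj {R : realType} {n : nat} {X : topologicalType}
    {A : smooth_atlas R n X} (J g g' : matrix_field A) (r : R) c x :
  almost_complex_structure J -> dom c x ->
  fundamental_form J g' c x = r *: fundamental_form J g c x ->
  g' c x = r *: g c x.
Proof.
move=> [_ _ JJ] cx /(congr1 (mulmx (J c x))).
rewrite /fundamental_form -scalemxAr !mulmxA JJ// !mulNmx !mul1mx scalerN.
exact: oppr_inj.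
Qed.

Theorem lemma3p2 (R : realType) (X : topologicalType)
    (X_hausdorff : hausdorff_space X) (X_compact : compact [set: X])
    (A : smooth_atlas R 4 X)
    (J : matrix_field A) (J_acs : almost_complex_structure J)
    (g g' : matrix_field A)
    (g_hermitian : hermitian_metric J g)
    (g'_hermitian : hermitian_metric J g')
    (Phi : X -> R)
    (Phi_smooth : smooth_function A Phi)
    (Phi_gt0 : forall x, 0 < Phi x)
    (conformal : forall c x, dom c x ->
       fundamental_form J g' c x = Phi x *: fundamental_form J g c x) :
  hodge_number J g' 1 1 = hodge_number J g 1 1.
Proof.
have gg' c x : dom c x -> g' c x = Phi x *: g c x.
  by move=> cx; exact: fundamental_form_inj J_acs cx (conformal c x cx).
rewrite /hodge_number.
suff -> : @Defs.harmonic _ _ _ A J g' 1 1 = @Defs.harmonic _ _ _ A J g 1 1 by [].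
rewrite eqEsubset; split; last first.
  exact: (harmonic11_conformal J g g' Phi g_hermitian.1 Phi_gt0 gg').
(* The other inclusion exchanges the two metrics, with conformal factor the inverse of [Phi]. *)
have Phi_inv_gt0 x : 0 < (Phi x)^-1 by rewrite invr_gt0.
apply: (harmonic11_conformal J g' g _ g'_hermitian.1 Phi_inv_gt0) => c x /gg' ->.
by rewrite scalerA mulVf ?scale1r// gt_eqF.
Qed.
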